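(* Let $\mu=(\mu_1\ge\dots\ge\mu_k>0)$ be any partition of $n$, and let $\mathcal S$ and $\mathcal T$ be the sets of all diagrams $S$ and $T$, respectively, arising from the drawings associated to $\mu$ (as defined in the context). Then the family $\{\partial_S\Delta_\mu\}_{S\in\mathcal S}$ is linearly independent and is a basis of $M_\mu^0$; and the family $\{\partial_T\Delta_\mu\}_{T\in\mathcal T}$ is linearly independent and is a basis of $M_\mu^{n(\mu)}$.
   Context: Polynomials are in $x_1,\dots,x_n,y_1,\dots,y_n$ over $\mathbb Q$. The set of biexponents of $\mu$ is $\{(i,j): 0\le i\le k-1,\ 0\le j\le\mu_{i+1}-1\}$; list it in lexicographic order as $(p_1,q_1),\dots,(p_n,q_n)$ and set $\Delta_\mu=\det(x_i^{p_j}y_i^{q_j})_{1\le i,j\le n}$. $M_\mu$ is the linear span of all partial derivatives (of all orders) of $\Delta_\mu$. Put $n(\mu)=\sum_{i=1}^k(i-1)\mu_i$. $M_\mu^0$ (resp. $M_\mu^{n(\mu)}$) is the subspace of $M_\mu$ of elements that are homogeneous of total degree $0$ (resp. $n(\mu)$) in the variables $x_1,\dots,x_n$. A shape is an arrangement, from left to right at places $1,\dots,n-1$, of $n-1$ bars; each bar has $n_x$ $x$-cells and $n_y$ $y$-cells, and the pairs $(n_x,n_y)$ run exactly once through the biexponents of $\mu$ other than $(0,0)$. A drawing is a shape in which some cells are crossed (the other cells are white; only the number of crossed $x$-cells and of crossed $y$-cells in each bar matters), subject to the rules: (1) among bars with the same number of $x$-cells, the number of $y$-cells decreases from left to right; (2)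 every $x$-cell is crossed; (3) whenever a bar $B$ is to the left of a bar having more $x$-cells than $B$ and having $q$ $y$-cells, $B$ has at least $q+1$ white $y$-cells. For a drawing, $S$ (resp. $T$) is the diagram consisting only of its crossed cells (resp. only of its white cells), recorded by the number of $x$-cells and $y$-cells at each place. If a diagram $U$ has $a_i$ $x$-cells and $b_i$ $y$-cells at place $i$, $\partial_U=\prod_{i=1}^{n-1}\partial_{x_i}^{a_i}\partial_{y_i}^{b_i}$. $\mathcal S$, $\mathcal T$ are the sets of all $S$'s and all $T$'s obtained from drawings. *)

(* Defs.v *)
From HB Require Import structures.
From mathcomp Require Import all_boot all_order all_algebra.
From mathcomp.multinomials Require Import mpoly.

Set Implicit Arguments.
Unset Strict Implicit.
Unset Printing Implicit Defensive.

Import GRing.Theory.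

Local Open Scope ring_scope.

Section LinearFamilies.

Variables (K : fieldType) (V : lmodType K) (I : eqType).
Implicit Types (A : I -> Prop) (v : I -> V) (W : V -> Prop).

(* [A] selects the index set of the family [v], which may be infinite. *)
Definition in_span A v (w : V) : Prop :=
  exists (s : seq I) (c : I -> K),
    (forall i, i \in s -> A i) /\ w = \sum_(i <- s) c i *: v i.

Definition lin_indep A v : Prop :=
  forall (s : seq I) (c : I -> K),
    uniq s -> (forall i, i \in s -> A i) ->
    \sum_(i <- s) c i *: v i = 0 -> forall i, i \in s -> c i = 0.

Definition is_basis A v W : Prop :=
  lin_indep A v /\ (forall w, W w <-> in_span A v w).

End LinearFamilies.

Definition is_partition (n : nat) (mu : seq nat) : Prop :=
  [/\ sorted geq mu, all (leq 1) mu & sumn mu = n].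

(* In lexicographic order. *)
Definition biexponents (mu : seq nat) : seq (nat * nat) :=
  [seq (i, j) | i <- iota 0 (size mu), j <- iota 0 (nth 0%N mu i)].

(* Rows are numbered from 0 here, hence no [i - 1]. *)
Definition nmu (mu : seq nat) : nat :=
  (\sum_(i < size mu) i * nth 0 mu i)%N.

Section Polynomials.

Variable n : nat.

Definition xvar (i : 'I_n) : 'I_(n + n) := lshift n i.
Definition yvar (i : 'I_n) : 'I_(n + n) := rshift n i.

(* For [mu] a partition of [n], [biexponents mu] has size [n], so the default
   value of [nth] is never used. *)
Definition Delta (mu : seq nat) : {mpoly rat[n + n]} :=
  \det (\matrix_(i < n, j < n)
          ('X_(xvar i) ^+ (nth (0, 0)%N (biexponents mu) j).1 *
           'X_(yvar i) ^+ (nth (0, 0)%N (biexponents mu) j).2)).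

Definition Mmu (mu : seq nat) (p : {mpoly rat[n + n]}) : Prop :=
  in_span (fun _ : 'X_{1..n + n} => True) (fun m => (Delta mu)^`M[m]) p.

Definition xdeg (m : 'X_{1..n + n}) : nat := (\sum_(i < n) m (xvar i))%N.

Lemma xdeg0 : xdeg 0%MM = 0%N.
Proof. by rewrite /xdeg big1 // => i _; rewrite mnm0E. Qed.

Lemma xdegD : {morph xdeg : m1 m2 / (m1 + m2)%MM >-> (m1 + m2)%N}.
Proof.
move=> m1 m2; rewrite /xdeg -big_split /=.
by apply: eq_bigr => i _; rewrite mnmDE.
Qed.

HB.instance Definition _ := isMeasure.Build (n + n)%N xdeg xdeg0 xdegD.

Definition Mmu_xdeg (mu : seq nat) (d : nat) (p : {mpoly rat[n + n]}) : Prop :=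
  Mmu mu p /\ p \is d.-homog for xdeg.

End Polynomials.

(* [U i] is the pair (number of x-cells, number of y-cells) at the place [i];
   the n - 1 places are numbered from 0. *)
Definition diagram (n : nat) : eqType := {ffun 'I_n.-1 -> nat * nat}.

(* The place [i] carries the variables x_i and y_i; x_n and y_n have no place. *)
Definition place (n : nat) (i : 'I_n.-1) : 'I_n := widen_ord (leq_pred n) i.

Definition diag_mon (n : nat) (U : diagram n) : 'X_{1..n + n} :=
  (\sum_(i < n.-1) (U_(xvar (place i)) *+ (U i).1
                    + U_(yvar (place i)) *+ (U i).2))%MM.

Definition diag_deriv (n : nat) (U : diagram n) (p : {mpoly rat[n + n]}) :
  {mpoly rat[n + n]} := p^`M[diag_mon U].

Definition is_shape (n : nat) (mu : seq nat) (B : diagram n) : Prop :=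
  perm_eq (codom B) [seq p <- biexponents mu | p != (0, 0)%N].

Definition white (n : nat) (B C : diagram n) : diagram n :=
  [ffun i => ((B i).1 - (C i).1, (B i).2 - (C i).2)%N].

(* [B] gives the bars and [C] the numbers of crossed cells in each bar. *)
Record is_drawing (n : nat) (mu : seq nat) (B C : diagram n) : Prop := IsDrawing {
  drawing_shape : is_shape mu B;
  drawing_crossed_x : forall i, ((C i).1 <= (B i).1)%N;
  drawing_crossed_y : forall i, ((C i).2 <= (B i).2)%N;
  drawing_rule1 : forall i j : 'I_n.-1,
    (i < j)%N -> (B i).1 = (B j).1 -> ((B j).2 < (B i).2)%N;
  drawing_rule2 : forall i, (C i).1 = (B i).1;
  drawing_rule3 : forall i j : 'I_n.-1,
    (i < j)%N -> ((B i).1 < (B j).1)%N ->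
    ((B j).2 + 1 <= (white B C i).2)%N
}.

Definition S_diagrams (n : nat) (mu : seq nat) (S : diagram n) : Prop :=
  exists B C : diagram n, is_drawing mu B C /\ S = C.

Definition T_diagrams (n : nat) (mu : seq nat) (T : diagram n) : Prop :=
  exists B C : diagram n, is_drawing mu B C /\ T = white B C.

(* Main.v *)
Require Import Defs.
From HB Require Import structures.
From mathcomp Require Import all_boot all_order all_algebra all_fingroup.
From mathcomp.multinomials Require Import mpoly.
From mathcomp Require Import zify.

(* Read from left to right, a drawing removes corners from the Young diagram of
   [mu], and it can be recovered from the word w_1 ... w_(n-1) of its numbers of
   white y-cells: w_i may be any column of the current diagram, and the bar is
   the corner in the lowest row meeting this column. Hence the number of drawings
   is the multinomial coefficient N of the column heights.

   Up to a nonzero factor, d_S d_T' Delta is the sign of S + T' as an arrangement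
   of the biexponents, or 0 if it is not one, and it vanishes when the word of T'
   is lexicographically larger than that of S. The pairing of the S with the T is
   thus a triangular matrix with nonzero diagonal, so both families are free.

   The T span by an orbit argument: Delta is the lowest homogeneous part in y of
   det (x_i^p exp(a_q y_i)), whose exponents (a_q) run over an orbit of N points,
   so the top part of a polynomial vanishing on the orbit annihilates Delta. Any
   N + 1 monomials in y have a nonzero combination vanishing on the orbit. Finally
   an element of M^0 is determined by its pairing with the N forms d_T, so the S
   span M^0. *)

Set Implicit Arguments.
Unset Strict Implicit.
Unset Printing Implicit Defensive.

Import GRing.Theory.

(** * Drawings as words *)

(** Trailing zeros are allowed: rows emptied by the removal of boxes are kept, so that row indices
    remain x-exponents. *)
Definition antitone (nu : seq nat) :=
  forall i j, i <= j -> nth 0 nu j <= nth 0 nu i.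

(** In an antitone sequence the rows longer than [w] come first, so for a nonempty column [w] this
    is the index of the last row meeting it. *)
Definition corner (nu : seq nat) (w : nat) : nat :=
  (count (fun a => w < a) nu).-1.

Definition rmbox (nu : seq nat) (p : nat) : seq nat :=
  set_nth 0 nu p (nth 0 nu p).-1.

Definition nonzero_biexponents (nu : seq nat) : seq (nat * nat) :=
  [seq p <- biexponents nu | p != (0, 0)].

Lemma sorted_antitone nu : sorted geq nu -> antitone nu.
Proof.
move=> nuS i j le_ij; have [lt_j|ge_j] := ltnP j (size nu); last first.
  by rewrite [X in X <= _]nth_default.
have geqT : transitive geq by move=> y x z /= h1 h2; apply: leq_trans h2 h1.
apply: (sorted_leq_nth geqT leqnn 0 nuS) => //.
by rewrite inE (leq_ltn_trans le_ij).
Qed.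

Lemma ltn_count_gt nu w i :
  antitone nu -> (i < count (fun a => w < a) nu) = (w < nth 0 nu i).
Proof.
elim: nu i => [|a nu IH] i nuA; first by rewrite nth_nil.
have nuA' : antitone nu by move=> k l le_kl; apply: (nuA k.+1 l.+1).
case: i => [|i] /=; last first.
  have [lt_wa|le_aw] := ltnP w a; first by rewrite add1n ltnS IH.
  rewrite IH //; have := nuA 0 i.+1 isT; have := nuA 0 i.+2 isT => /=; lia.
have [lt_wa|le_aw] := ltnP w a; first by rewrite add1n.
by rewrite IH //; have := nuA 0 1 isT => /=; lia.
Qed.

Lemma count_corner nu w : antitone nu -> w < nth 0 nu 0 ->
  count (fun a => w < a) nu = (corner nu w).+1.
Proof. by move=> nuA; rewrite -ltn_count_gt // /corner; lia. Qed.

Lemma lt_corner nu w : antitone nu -> w < nth 0 nu 0 ->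
  w < nth 0 nu (corner nu w).
Proof.
by move=> nuA lt_w; rewrite -ltn_count_gt // count_corner.
Qed.

Lemma corner_le nu w p : antitone nu -> w < nth 0 nu 0 ->
  corner nu w < p -> nth 0 nu p <= w.
Proof.
by move=> nuA lt_w lt_p; rewrite leqNgt -ltn_count_gt // count_corner // -leqNgt.
Qed.

Lemma corner_uniq nu w p : antitone nu ->
  w < nth 0 nu p -> nth 0 nu p.+1 <= w -> corner nu w = p.
Proof.
move=> nuA; rewrite [nth _ _ _ <= _]leqNgt -!ltn_count_gt // /corner; lia.
Qed.

Lemma nth_rmbox nu p i :
  nth 0 (rmbox nu p) i = if i == p then (nth 0 nu p).-1 else nth 0 nu i.
Proof. by rewrite /rmbox nth_set_nth. Qed.

Lemma rmbox_antitone nu p : antitone nu ->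
  nth 0 nu p.+1 < nth 0 nu p -> antitone (rmbox nu p).
Proof.
move=> nuA lt_p i j le_ij; rewrite !nth_rmbox.
case: (eqVneq j p) => [jp|ne_j]; case: (eqVneq i p) => [ip|ne_i] //.
- by have := nuA i p; lia.
- by have := nuA p.+1 j; lia.
- exact: nuA.
Qed.

Lemma rmbox_corner_antitone nu w : antitone nu -> w < nth 0 nu 0 ->
  antitone (rmbox nu (corner nu w)).
Proof.
move=> nuA lt_w; apply: rmbox_antitone => //.
exact: leq_ltn_trans (corner_le nuA lt_w (leqnn _)) (lt_corner nuA lt_w).
Qed.

Lemma mem_biexponents nu b : (b \in biexponents nu) = (b.2 < nth 0 nu b.1).
Proof.
case: b => i j /=; apply/allpairsPdep/idP => [[k [l []]]|lt_j].
  by rewrite !mem_iota /= => _ lt_l [-> ->].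
exists i, j; rewrite !mem_iota /= !add0n; split=> //.
by case: (ltnP i (size nu)) => // le_i; rewrite nth_default in lt_j.
Qed.

Lemma biexponents_uniq nu : uniq (biexponents nu).
Proof.
apply: allpairs_uniq_dep => [|x _|]; rewrite ?iota_uniq //.
by case=> [x1 x2] [y1 y2] _ _ /= [-> ->].
Qed.

Lemma perm_biexponents_rmbox nu p : 0 < nth 0 nu p ->
  perm_eq (biexponents nu) ((p, (nth 0 nu p).-1) :: biexponents (rmbox nu p)).
Proof.
move=> nz_p; apply: uniq_perm; rewrite /= ?biexponents_uniq // ?andbT.
  by rewrite mem_biexponents /= nth_rmbox eqxx ltnn.
move=> [i j]; rewrite inE !mem_biexponents /= nth_rmbox xpair_eqE.
by case: (altP (i =P p)) => [->|] //=; lia.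
Qed.

Lemma size_biexponents nu : size (biexponents nu) = sumn nu.
Proof.
rewrite size_allpairs_dep sumnE big_map.
rewrite (eq_bigr (fun i => nth 0 nu i)); last by move=> i _; rewrite size_iota.
by rewrite sumnE [RHS](big_nth 0) /index_iota subn0.
Qed.

Lemma sumn_rmbox nu p : 0 < nth 0 nu p -> sumn nu = (sumn (rmbox nu p)).+1.
Proof.
move=> nz_p; rewrite -!size_biexponents.
by rewrite (perm_size (perm_biexponents_rmbox nz_p)).
Qed.

Lemma perm_nonzero_biexponents_rmbox nu p : 0 < nth 0 nu p ->
  (p, (nth 0 nu p).-1) != (0, 0) ->
  perm_eq (nonzero_biexponents nu)
          ((p, (nth 0 nu p).-1) :: nonzero_biexponents (rmbox nu p)).
Proof.
move=> nz_p nz; rewrite /nonzero_biexponents.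
by rewrite (permPl (perm_filter _ (perm_biexponents_rmbox nz_p))) /= nz.
Qed.

(* A drawing is determined by its white y-cells: a bar with [w] white cells,
   met when the diagram of the biexponents still to be placed is [nu], is the
   last box of the row at the bottom of the column [w] of [nu]. *)
Fixpoint words (nu : seq nat) (m : nat) : seq (seq nat) :=
  if m is m'.+1 then
    [seq w :: v | w <- iota 0 (nth 0 nu 0),
                  v <- words (rmbox nu (corner nu w)) m']
  else [:: [::]].

Fixpoint bars (nu : seq nat) (v : seq nat) : seq (nat * nat) :=
  if v is w :: v' then
    let p := corner nu w in (p, (nth 0 nu p).-1) :: bars (rmbox nu p) v'
  else [::].

Lemma wordsP nu m w v : reflect (w < nth 0 nu 0 /\
  v \in words (rmbox nu (corner nu w)) m) (w :: v \in words nu m.+1).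
Proof.
apply: (iffP allpairsPdep) => [[w' [v' [lt_w' v'P [-> ->]]]]|[lt_w vP]].
  by rewrite mem_iota in lt_w'.
by exists w, v; rewrite mem_iota.
Qed.

Lemma size_words nu m v : v \in words nu m -> size v = m.
Proof.
elim: m nu v => [|m IH] nu [|w v].
- by [].
- by rewrite inE.
- by case/allpairsPdep => ? [? []].
- by case/wordsP => _ /IH /= ->.
Qed.

Lemma size_bars nu v : size (bars nu v) = size v.
Proof. by elim: v nu => //= w v IH nu; rewrite IH. Qed.

(** Rules 1 and 3 for a bar [u] to the left of a bar [v]; a bar is paired with its number of white
    y-cells. *)
Definition rules (u v : (nat * nat) * nat) : bool :=
  ((u.1.1 == v.1.1) ==> (v.1.2 < u.1.2)) && ((u.1.1 < v.1.1) ==> (v.1.2 < u.2)).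

(** The first bar is forced by its number [w] of white cells. Rule 1 against the last box of its row
    [p] shows that the bar is this box; rule 3 against the last box of row [p.+1] shows that this
    row does not reach column [w]. Hence [p] is [corner nu w], and induction applies to the diagram
    without this box. *)
Lemma drawing_word nu z : antitone nu -> size z = (sumn nu).-1 ->
  perm_eq (unzip1 z) (nonzero_biexponents nu) ->
  all (fun u => u.2 <= u.1.2) z -> pairwise rules z ->
  unzip2 z \in words nu (sumn nu).-1 /\ unzip1 z = bars nu (unzip2 z).
Proof.
elim: z nu => [|[[p q] w] z IH] nu nuA /=; first by move=> <-.
move=> szE zP /andP[/= le_wq z_all] /andP[z_rules z_pw].
have b_nz : (p, q) \in nonzero_biexponents nu.
  by rewrite -(perm_mem zP) mem_head.
(* Any other nonzero biexponent sits further right, where the rules compare it with the first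
   bar. *)
have mem_z b : b \in nonzero_biexponents nu -> b = (p, q) \/
    exists2 w', (b, w') \in z & rules ((p, q), w) (b, w').
  rewrite -(perm_mem zP) inE => /predU1P[->|]; first by left.
  case/mapP => -[b' w'] b'z /= ->; right; exists w' => //.
  exact: (allP z_rules).
have := b_nz; rewrite mem_filter mem_biexponents /= => /andP[nz_pq lt_q].
have qE : q = (nth 0 nu p).-1.
  have [//|ne_q] := eqVneq q (nth 0 nu p).-1.
  case: (mem_z (p, (nth 0 nu p).-1)) => [|[]|[w' _]].
  - by rewrite mem_filter xpair_eqE mem_biexponents /=; lia.
  - by move/eqP: ne_q.
  - by case/andP; rewrite /= eqxx; lia.
have le_w : nth 0 nu p.+1 <= w.
  rewrite leqNgt; apply/negP => lt_w.
  case: (mem_z (p.+1, (nth 0 nu p.+1).-1)) => [|[]|[w' _]].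
  - by rewrite mem_filter xpair_eqE mem_biexponents /=; lia.
  - lia.
  - by case/andP; rewrite /=; lia.
have cE : corner nu w = p by apply: corner_uniq => //; lia.
have lt_w0 : w < nth 0 nu 0 by have := nuA 0 p; lia.
have nz_p : 0 < nth 0 nu p by lia.
have sumE := sumn_rmbox nz_p.
have [|||||vP barsE] := IH (rmbox nu p).
- by rewrite -cE; apply: rmbox_corner_antitone.
- by move: szE; rewrite sumE /= => <-.
- rewrite -(perm_cons (p, q)) (permPl zP) qE.
  by apply: perm_nonzero_biexponents_rmbox; rewrite -?qE.
- by [].
- by [].
split; last by rewrite cE -qE -barsE.
have -> : (sumn nu).-1 = (sumn (rmbox nu p)).-1.+1 by move: szE; rewrite sumE /= => <-.
by apply/wordsP; rewrite cE.
Qed.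

(** Rule 1 holds because each bar is the last box of its row when removed; rule 3 holds because the
    rows below the corner have length at most [w]. *)
Lemma word_drawing nu v : antitone nu -> v \in words nu (sumn nu).-1 ->
  [/\ perm_eq (bars nu v) (nonzero_biexponents nu),
      all (fun u => u.2 <= u.1.2) (zip (bars nu v) v)
    & pairwise rules (zip (bars nu v) v)].
Proof.
elim: v nu => [|w v IH] nu nuA vP.
  have /= sum1 := esym (size_words vP).
  split=> //; rewrite /nonzero_biexponents.
  suff /all_filterP : all (fun b => b == (0, 0)) (biexponents nu).
    move=> <-; rewrite -filter_predI (eq_filter (a2 := pred0)) ?filter_pred0 //.
    by move=> b /=; rewrite andNb.
  apply/allP => b bP; have := bP; rewrite mem_biexponents => lt_b.
  move: sum1 bP; rewrite -size_biexponents.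
  have : (0, 0) \in biexponents nu.
    by rewrite mem_biexponents /=; have := nuA 0 b.1; lia.
  case: (biexponents nu) => [|b1 [|]] //; rewrite !inE => /eqP <- _ //.
have /= sumE := size_words vP.
move: vP; rewrite -sumE => /wordsP[lt_w vP] /=.
set p := corner nu w; have lt_wp := lt_corner nuA lt_w.
have nz_p : 0 < nth 0 nu p by rewrite -/p in lt_wp; lia.
have sumE' := sumn_rmbox nz_p.
have nuA' := rmbox_corner_antitone nuA lt_w.
have /IH[//|permP allP' pwP] : v \in words (rmbox nu p) (sumn (rmbox nu p)).-1.
  move: vP; rewrite (_ : size v = (sumn (rmbox nu p)).-1) //.
  by move: sumE; rewrite sumE' /= => <-.
split.
- rewrite perm_sym (permPl (perm_nonzero_biexponents_rmbox nz_p _)).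
    by rewrite perm_cons perm_sym.
  (* If the removed box were (0,0), it would be the only one left, whereas a nonempty word requires
     at least two boxes. *)
  rewrite xpair_eqE; apply/negP => /andP[/eqP p0 /eqP nu0].
  have := corner_le nuA lt_w; rewrite -/p p0 => le_w.
  rewrite -/p p0 in lt_wp nu0.
  suff: sumn nu <= 1 by move: sumE; lia.
  rewrite -size_biexponents.
  have sub1 : {subset biexponents nu <= [:: (0, 0)]}.
    move=> [i j]; rewrite mem_biexponents inE xpair_eqE /=.
    by case: i => [|i]; [|have := le_w i.+1 isT]; lia.
  exact: (uniq_leq_size (biexponents_uniq nu) sub1).
- by rewrite allP' andbT; rewrite -/p in lt_wp; lia.
rewrite pwP andbT; apply/allP => -[[i j] w'] /(map_f fst) /= ijP.
have : (i, j) \in nonzero_biexponents (rmbox nu p).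
  rewrite -(perm_mem permP); move: ijP; rewrite -/unzip1 unzip1_zip //.
  by rewrite size_bars.
rewrite mem_filter mem_biexponents nth_rmbox /= => /andP[_].
rewrite /rules /=; case: (altP (i =P p)) => [->|ne_i] lt_j.
  by rewrite eqxx ltnn andbT.
rewrite eq_sym (negPf ne_i) /=; apply/implyP => lt_p.
by have := corner_le nuA lt_w lt_p; lia.
Qed.

(** The exponent pairs of S + T', where S consists of the crossed cells for [v] and T' of the white
    cells for [v']. *)
Fixpoint mixed_bars (nu v v' : seq nat) : seq (nat * nat) :=
  match v, v' with
  | w :: u, w' :: u' => let p := corner nu w in
    (p, (nth 0 nu p).-1 - w + w') :: mixed_bars (rmbox nu p) u u'
  | _, _ => [::]
  end.

Lemma pairwise_allpairs_cons (r : rel (seq nat)) ws (t : nat -> seq (seq nat)) :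
  pairwise ltn ws ->
  (forall w, w \in ws -> pairwise (fun v v' => r (w :: v) (w :: v')) (t w)) ->
  (forall w w' v v', w \in ws -> w < w' -> r (w :: v) (w' :: v')) ->
  pairwise r [seq w :: v | w <- ws, v <- t w].
Proof.
elim: ws => //= w ws IH /andP[/allP lt_w wsP] rE rL.
rewrite pairwise_cat IH //; first last.
- by move=> w1 w2 v v' w1P; apply: rL; rewrite inE w1P orbT.
- by move=> w1 w1P; apply: rE; rewrite inE w1P orbT.
rewrite andbT pairwise_map rE ?mem_head // andbT.
apply/allrelP => _ _ /mapP[v _ ->] /allpairsPdep[w' [v' [w'P _ ->]]].
by apply: rL; rewrite ?mem_head //; apply: lt_w.
Qed.

(* In lexicographic order, the crossed cells of a word never complete the white
   cells of a larger word to a shape. *)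
Lemma pairwise_words nu m : antitone nu ->
  pairwise (fun v v' => ~~ perm_eq (mixed_bars nu v v') (nonzero_biexponents nu))
           (words nu m).
Proof.
elim: m nu => // m IH nu nuA; apply: pairwise_allpairs_cons => [|w|w w' v v'].
- by rewrite -(sorted_pairwise ltn_trans) iota_ltn_sorted.
(* With equal first letters the first entry is the corner itself; cancelling it leads to the smaller
   diagram. *)
- rewrite mem_iota /= => lt_w; have lt_p := lt_corner nuA lt_w.
  have := IH _ (rmbox_corner_antitone nuA lt_w); apply: sub_pairwise => v v'.
  apply: contra; set p := corner nu w; rewrite subnK; last by rewrite -/p in lt_p; lia.
  move=> pP; rewrite -(perm_cons (p, (nth 0 nu p).-1)) (permPl pP).
  apply: perm_nonzero_biexponents_rmbox; first by rewrite -/p in lt_p; lia.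
  have := perm_mem pP (p, (nth 0 nu p).-1); rewrite mem_head mem_filter.
  by case/esym/andP.
(* Since [w < w'], the first entry lies beyond the end of its row, so it is not a biexponent. *)
rewrite mem_iota /= => lt_w lt_ww'; have lt_p := lt_corner nuA lt_w.
apply/negP => /perm_mem /(_ (corner nu w, (nth 0 nu (corner nu w)).-1 - w + w')).
rewrite mem_head mem_filter mem_biexponents /= => /esym/andP[_]; lia.
Qed.

(** * Counting words and rearrangements *)

Lemma sum_column_heights nu M : nth 0 nu 0 <= M -> antitone nu ->
  \sum_(0 <= j < M) count (fun a => j < a) nu = sumn nu.
Proof.
move=> le_M nuA; have {le_M} : all (fun a => a <= M) nu.
  apply/(all_nthP 0) => i _; exact: leq_trans (nuA 0 i _) le_M.
elim: nu {nuA} => [|a nu IH] /=; first by rewrite big1.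
case/andP => le_a /IH <-; rewrite big_split /=; congr addn.
have big_out : \sum_(a <= j < M) (j < a) = 0.
  by rewrite big_nat big1 // => j /andP[le_j _]; rewrite ltnNge le_j.
have big_in : \sum_(0 <= j < a) (j < a) = a.
  rewrite big_nat (eq_bigr (fun=> 1)) => [|j /andP[_ ->] //].
  by rewrite -big_nat sum_nat_const_nat subn0 muln1.
by rewrite (big_cat_nat _ le_a) //= big_in big_out addn0.
Qed.

Lemma count_rmbox nu w j : antitone nu -> w < nth 0 nu 0 ->
  let c := (nth 0 nu (corner nu w)).-1 in
  count (fun a => j < a) nu
    = count (fun a => j < a) (rmbox nu (corner nu w)) + (j == c).
Proof.
move=> nuA lt_w /=; set p := corner nu w.
have lt_p : w < nth 0 nu p := lt_corner nuA lt_w.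
have lt_size : p < size nu.
  by rewrite ltnNge; apply/negP => le_p; rewrite nth_default in lt_p.
rewrite /rmbox count_set_nth_ltn //.
have : has (fun a => j < a) nu || (nth 0 nu p <= j).
  case: leqP; rewrite ?orbT // orbF => lt_j; apply/hasP; exists (nth 0 nu p) => //.
  exact: mem_nth.
rewrite has_count; lia.
Qed.

(** Induction on the first letter [w]. The removed box lies in a column ending in the same row as
    column [w], hence of the same height, so [w] contributes a factorial times this height; the
    heights add up to the number of boxes. *)
Lemma card_words nu m M : antitone nu -> nth 0 nu 0 <= M -> sumn nu = m.+1 ->
  size (words nu m) * \prod_(0 <= j < M) (count (fun a => j < a) nu)`! = m.+1`!.
Proof.
elim: m nu => [|m IH] nu nuA le_M sumE.
  (* A single box: every column height is 0 or 1. *)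
  rewrite mul1n big_nat big1 // => j /andP[_ lt_j].
  have := sum_column_heights le_M nuA; rewrite sumE.
  rewrite (big_rem j) /= ?mem_index_iota //.
  by case: count => [|[|]].
rewrite size_allpairs_dep sumnE big_map big_distrl /=.
have lt0 w : w < nth 0 nu 0 ->
    size (words (rmbox nu (corner nu w)) m)
      * \prod_(0 <= j < M) (count (fun a => j < a) nu)`!
    = m.+1`! * count (fun a => w < a) nu.
  move=> lt_w; set p := corner nu w; have lt_p : w < nth 0 nu p := lt_corner nuA lt_w.
  have nz_p : 0 < nth 0 nu p by lia.
  have lt_c : (nth 0 nu p).-1 < M by have := nuA 0 p; lia.
  rewrite -(IH (rmbox nu p)); first last.
  - by have := sumn_rmbox nz_p; lia.
  - by rewrite nth_rmbox; case: eqP => [<-|_]; lia.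
  - exact: rmbox_corner_antitone.
  rewrite -!mulnA; congr muln.
  rewrite (bigD1_seq (nth 0 nu p).-1) ?iota_uniq ?mem_index_iota //=.
  rewrite [in RHS](bigD1_seq (nth 0 nu p).-1) ?iota_uniq ?mem_index_iota //=.
  have cE : count (fun a => (nth 0 nu p).-1 < a) nu = count (fun a => w < a) nu.
    rewrite (count_corner nuA lt_w) -/p; apply/eqP.
    have := ltn_count_gt (nth 0 nu p).-1 p nuA.
    have := ltn_count_gt (nth 0 nu p).-1 p.+1 nuA.
    have := corner_le nuA lt_w (leqnn p.+1); lia.
  rewrite -cE (count_rmbox (nth 0 nu p).-1 nuA lt_w) -/p eqxx addn1 factS.
  rewrite -mulnA [RHS]mulnC; congr (_ * (_ * _)).
  apply: eq_bigr => j /negPf ne_j.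
  by rewrite (count_rmbox j nuA lt_w) -/p ne_j addn0.
transitivity (\sum_(w <- iota 0 (nth 0 nu 0)) m.+1`! * count (fun a => w < a) nu).
  by apply: eq_big_seq => w; rewrite mem_iota => /andP[_]; apply: lt0.
rewrite -big_distrr /= [RHS]factS mulnC -sumE; congr muln.
by rewrite -(sum_column_heights (leqnn _) nuA) /index_iota subn0.
Qed.

(** The same recursion as for words, with multiplicities of letters in place of column heights. *)
Lemma card_permutations s M : all (fun a => a < M) s ->
  size (permutations s) * \prod_(0 <= j < M) (count_mem j s)`! = (size s)`!.
Proof.
move Em: (size s) => m; elim: m s Em => [|m IH] s szE sM.
  by rewrite (size0nil szE) big1.
have s_gt0 : 0 < size s by rewrite szE.
rewrite (perm_size (permutationsE s_gt0)) size_allpairs_dep sumnE big_map big_distrl /=.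
have sE x : x \in s -> size (permutations (rem x s))
      * \prod_(0 <= j < M) (count_mem j s)`! = m`! * count_mem x s.
  move=> xs; have lt_x := allP sM _ xs.
  rewrite -(IH (rem x s)); first last.
  - by apply/allP => y /mem_rem /(allP sM).
  - by rewrite size_rem // szE.
  rewrite -!mulnA; congr muln.
  rewrite (bigD1_seq x) ?iota_uniq ?mem_index_iota //=.
  rewrite [in RHS](bigD1_seq x) ?iota_uniq ?mem_index_iota //=.
  have cE y : count_mem y s = count_mem y (rem x s) + (y == x).
    by rewrite (seq.permP (perm_to_rem xs)) /= addnC eq_sym.
  rewrite [count_mem x s]cE eqxx addn1 factS.
  rewrite -mulnA [RHS]mulnC; congr (_ * (_ * _)).
  by apply: eq_bigr => j /negPf ne_j; rewrite cE ne_j addn0.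
transitivity (\sum_(x <- undup s) m`! * count_mem x s).
  by apply: eq_big_seq => x; rewrite mem_undup; apply: sE.
rewrite -big_distrr /= [RHS]factS mulnC; congr muln.
by rewrite -szE -[RHS](perm_size (perm_count_undup s)) size_flatten /shape -map_comp
  sumnE big_map; apply: eq_bigr => x _; rewrite /= size_nseq.
Qed.

(** * Determinants indexed by the biexponents *)

(** A pair [b] in the diagram satisfies [b.2 + 1 <= nth 0 mu b.1], and one outside satisfies
    [nth 0 mu b.1 <= b.2]. Summed over the two set differences, these bounds contradict the
    hypotheses unless both differences are empty. *)
Lemma biexponents_extremal mu (s : seq (nat * nat)) :
  uniq s -> size s = size (biexponents mu) ->
  (\sum_(b <- s) nth 0 mu b.1 = \sum_(b <- biexponents mu) nth 0 mu b.1)%N ->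
  (\sum_(b <- s) b.2 <= \sum_(b <- biexponents mu) b.2)%N ->
  {subset s <= biexponents mu}.
Proof.
move=> Us szE; set B := biexponents mu in szE *.
have permI : perm_eq [seq b <- s | b \in B] [seq b <- B | b \in s].
  apply: uniq_perm; rewrite ?filter_uniq ?biexponents_uniq // => b.
  by rewrite !mem_filter andbC.
rewrite ![(\sum_(b <- s) _)%N](bigID (mem B)) ![(\sum_(b <- B) _)%N](bigID (mem s)) /=.
rewrite -!(big_filter s) -!(big_filter B) !(perm_big _ permI) /=.
set s' := [seq b <- s | b \notin B]; set B' := [seq b <- B | b \notin s].
move=> /addnI muE; rewrite leq_add2l => le_s.
have le_mu : (\sum_(b <- s') nth 0 mu b.1 <= \sum_(b <- s') b.2)%N.
  rewrite big_seq [leqRHS]big_seq; apply: leq_sum => b.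
  by rewrite mem_filter mem_biexponents -leqNgt => /andP[].
have lt_mu : (\sum_(b <- B') (b.2 + 1) <= \sum_(b <- B') nth 0 mu b.1)%N.
  rewrite big_seq [leqRHS]big_seq; apply: leq_sum => b.
  by rewrite mem_filter mem_biexponents addn1 => /andP[].
have B'0 : size B' = 0.
  move: lt_mu; rewrite -muE => /leq_trans/(_ le_mu)/leq_trans/(_ le_s).
  by rewrite big_split /= sum1_size -[leqRHS]addn0 leq_add2l leqn0 => /eqP.
have : size s' = 0.
  move: szE; rewrite -(count_predC (mem B) s) -(count_predC (mem s) B).
  rewrite -!size_filter (perm_size permI) => /addnI; rewrite -/s' => ->.
  exact: B'0.
move/size0nil => s'0 b bs; apply: contraT => bNB.
have : b \in s' by rewrite mem_filter bNB.
by rewrite s'0.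
Qed.

(** * Determinants with rows chosen by a labelling *)

Section RowDeterminants.

Local Open Scope ring_scope.

Variables (T : eqType) (R : comNzRingType) (n : nat) (g : T -> 'I_n -> R).
Implicit Types r : 'I_n -> T.

Let D r : R := \det (\matrix_(i, j) g (r i) j).

Lemma det_rows_perm r (s : 'S_n) :
  D (fun i => r (s i)) = (-1) ^+ s * D r.
Proof.
rewrite /D -det_perm -det_mulmx -row_permE; congr (\det _).
by apply/matrixP => i j; rewrite !mxE.
Qed.

Lemma det_rows_eq0 r i i' : i != i' -> r i = r i' -> D r = 0.
Proof.
move=> ne_i eq_r; apply: (determinant_alternate ne_i) => j.
by rewrite !mxE eq_r.
Qed.

Lemma det_rows_inj r : D r != 0 -> injective r.
Proof.
move=> nz i i' eq_r; apply/eqP; apply: contraNT nz => ne_i.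
by rewrite (det_rows_eq0 ne_i eq_r).
Qed.

Lemma det_rows_neq0 r : D r != 0 -> exists s : 'S_n, forall i, g (r i) (s i) != 0.
Proof.
move=> nz; have [s s_nz|all0] := pickP (fun s : 'S_n => [forall i, g (r i) (s i) != 0]).
  by exists s => i; apply: (forallP s_nz).
case/eqP: nz; rewrite /D /determinant big1 // => s _.
have /forallPn[i /negPn /eqP gi0] := negbT (all0 s).
by rewrite (bigD1 i) //= mxE gi0 mul0r mulr0.
Qed.

End RowDeterminants.

(** * Signs of arrangements and the exponential determinant *)

Section Biexponents.

Local Open Scope ring_scope.

Variables (n : nat) (mu : seq nat).
Hypothesis size_mu : sumn mu = n.

Definition bi (j : 'I_n) : nat * nat := nth (0, 0)%N (biexponents mu) j.

Let size_B : size (biexponents mu) = n.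
Proof. by rewrite size_biexponents. Qed.

Lemma bi_inj : injective bi.
Proof.
move=> i j /eqP; rewrite nth_uniq ?size_B ?ltn_ord ?biexponents_uniq // => /eqP.
exact: val_inj.
Qed.

Lemma codom_bi : codom bi = biexponents mu.
Proof.
apply: (@eq_from_nth _ (0, 0)%N) => [|i].
  by rewrite size_codom card_ord size_B.
rewrite size_codom card_ord => lt_i.
by rewrite codomE (nth_map (Ordinal lt_i)) ?size_enum_ord // /bi nth_enum_ord.
Qed.

Lemma sum_bi (F : nat * nat -> nat) :
  (\sum_(j < n) F (bi j) = \sum_(b <- biexponents mu) F b)%N.
Proof. by rewrite -codom_bi big_image. Qed.

Lemma sum_bi1 : (\sum_(j < n) (bi j).1)%N = nmu mu.
Proof.
rewrite (sum_bi (fun b => b.1)) big_allpairs_dep /nmu.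
rewrite -(big_mkord xpredT (fun i => i * nth 0 mu i)%N) /index_iota subn0.
apply: eq_bigr => i _.
by rewrite big_const_seq count_predT size_iota iter_addn_0 mulnC.
Qed.

Lemma bi_perm (r : 'I_n -> nat * nat) : injective r ->
  (forall i, r i \in biexponents mu) -> exists s : 'S_n, forall i, r i = bi (s i).
Proof.
move=> r_inj r_mem.
have lt_idx i : (index (r i) (biexponents mu) < n)%N by rewrite -size_B index_mem.
have f_inj : injective (fun i => Ordinal (lt_idx i)).
  move=> i j [] /(congr1 (nth (0, 0)%N (biexponents mu))).
  by rewrite !nth_index //; apply: r_inj.
by exists (perm f_inj) => i; rewrite permE /bi /= nth_index.
Qed.

(** The sign of [r] as an arrangement of the biexponents, or 0 if it is not one. *)
Definition rowcoef (r : 'I_n -> nat * nat) : rat :=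
  \det (\matrix_(i, j) (r i == bi j)%:R).

Lemma rowcoef_neq0 r : rowcoef r != 0 -> exists s : 'S_n, forall i, r i = bi (s i).
Proof.
case/(@det_rows_neq0 _ _ _ (fun b j => (b == bi j)%:R)) => s sP.
by exists s => i; have := sP i; case: (r i =P bi (s i)) => // _; rewrite eqxx.
Qed.

Lemma rowcoef_bi : rowcoef bi = 1.
Proof.
rewrite /rowcoef -[RHS](det1 _ n); congr (\det _); apply/matrixP => i j.
by rewrite !mxE (inj_eq bi_inj).
Qed.

Lemma rowcoef_perm (s : 'S_n) : rowcoef (fun i => bi (s i)) = (-1) ^+ s.
Proof.
rewrite /rowcoef (@det_rows_perm _ _ _ (fun b j => (b == bi j)%:R) bi).
by rewrite -/(rowcoef bi) rowcoef_bi mulr1.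
Qed.

Lemma eq_rowcoef r r' : r =1 r' -> rowcoef r = rowcoef r'.
Proof.
by move=> eq_r; congr (\det _); apply/matrixP => i j; rewrite !mxE eq_r.
Qed.

Lemma rowcoef_neq0P r : reflect (perm_eq (codom r) (biexponents mu)) (rowcoef r != 0).
Proof.
apply: (iffP idP) => [/rowcoef_neq0[s sE]|permB].
  rewrite -codom_bi; apply: uniq_perm.
  - by apply/injectiveP => i j; rewrite !sE => /bi_inj /perm_inj.
  - exact/injectiveP/bi_inj.
  move=> b; apply/codomP/codomP => -[i ->]; first by exists (s i).
  by exists (s^-1%g i); rewrite sE permKV.
have [||s sE] := @bi_perm r.
- by apply/injectiveP; rewrite /injectiveb /dinjectiveb -codomE (perm_uniq permB)
    biexponents_uniq.
- by move=> i; rewrite -(perm_mem permB) codom_f.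
by rewrite (eq_rowcoef sE) rowcoef_perm signr_eq0.
Qed.

(* The coefficient of x^(r.1) y^[r.2] in det (x_i^p exp(a_q y_i)), where y^[d]
   is a divided power and a_q = t ^ q. *)
Definition expcoef (t : rat) (r : 'I_n -> nat * nat) : rat :=
  \det (\matrix_(i, j) (((r i).1 == (bi j).1)%:R * t ^+ ((bi j).2 * (r i).2))).

(** This identifies the lowest part in y of the exponential determinant with a multiple of Delta. On
    arrangements of the biexponents both sides alternate. Elsewhere, a nonzero left side would make
    the pairs distinct and match their x-exponents with those of the biexponents, so
    [biexponents_extremal] would make them an arrangement. *)
Lemma expcoef_rowcoef t r : (\sum_i (r i).2 <= \sum_j (bi j).2)%N ->
  expcoef t r = expcoef t bi * rowcoef r.
Proof.
move=> le_r; pose g b j : rat := (b.1 == (bi j).1)%:R * t ^+ ((bi j).2 * b.2).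
have [r0|r_nz] := eqVneq (rowcoef r) 0; last first.
  have [s sE] := rowcoef_neq0 r_nz; rewrite (eq_rowcoef sE) rowcoef_perm mulrC.
  rewrite /expcoef -(@det_rows_perm _ _ _ g bi s); congr (\det _).
  by apply/matrixP => i j; rewrite !mxE sE.
rewrite r0 mulr0; apply/eqP; apply: contraT => nz.
have r_inj := det_rows_inj (g := g) nz; have [s sP] := det_rows_neq0 (g := g) nz.
have sE i : (r i).1 = (bi (s i)).1.
  by have := sP i; rewrite /g; case: ((r i).1 =P _) => // _; rewrite mul0r eqxx.
have sub_r : {subset codom r <= biexponents mu}.
  apply: biexponents_extremal.
  - exact/injectiveP.
  - by rewrite size_codom card_ord size_B.
  - rewrite -(sum_bi (fun b => nth 0 mu b.1)%N) big_image /=.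
    rewrite [RHS](reindex_inj (@perm_inj _ s)) /=.
    by apply: eq_bigr => i _; rewrite sE.
  - by rewrite -(sum_bi (fun b => b.2)) big_image.
have [|s' s'E] := @bi_perm r r_inj; first by move=> i; apply/sub_r/codom_f.
by move: r0; rewrite (eq_rowcoef s'E) rowcoef_perm => /eqP; rewrite signr_eq0.
Qed.

Lemma exists_nonroot (p : {poly rat}) : p != 0 -> exists t, p.[t] != 0.
Proof.
move=> nz_p; pose rs := [seq (i%:R : rat) | i <- iota 0 (size p)].
have [/allP rsP|/allPn[t _ nz_t]] := boolP (all (root p) rs); last by exists t.
have : (size rs < size p)%N.
  apply: max_poly_roots => //; first exact/allP.
  rewrite map_inj_uniq ?iota_uniq // => i j /eqP.
  by rewrite Num.Theory.eqr_nat => /eqP.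
by rewrite size_map size_iota ltnn.
Qed.

(* As a polynomial in [t], the determinant has a single term of maximal degree,
   by the rearrangement inequality. *)
Lemma exists_expcoef_neq0 : exists t, expcoef t bi != 0.
Proof.
pose A : 'M[{poly rat}]_n :=
  \matrix_(i, j) (((bi i).1 == (bi j).1)%:R * 'X^((bi j).2 * (bi i).2)).
suff [t tP] : exists t, (\det A).[t] != 0.
  exists t; move: tP; rewrite -horner_evalE -det_map_mx; apply: contraNneq => <-.
  apply/eqP; congr (\det _); apply/matrixP => i j; rewrite !mxE /=.
  by rewrite horner_evalE hornerM hornerXn; case: eqP => _; rewrite hornerC.
apply: exists_nonroot; pose d := (\sum_j (bi j).2 * (bi j).2)%N.
suff : (\det A)`_d = 1 by apply: contra_eqN => /eqP ->; rewrite coef0 eq_sym oner_eq0.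
rewrite /determinant coef_sum (bigD1 1%g) //= [X in _ + X]big1 ?addr0.
  rewrite odd_perm1 expr0 mul1r (eq_bigr (fun j => 'X^((bi j).2 * (bi j).2))).
    by rewrite prodrXr coefXn eqxx.
  by move=> i _; rewrite mxE perm1 eqxx mul1r.
move=> s ne_s.
rewrite mulr_sign.
suff s0 : (\prod_i A i (s i))`_d = 0 by case: (odd_perm s); rewrite ?coefN s0 ?oppr0.
have [/forallP s1|/forallPn[i si]] := boolP [forall i, (bi i).1 == (bi (s i)).1].
  rewrite (eq_bigr (fun i => 'X^((bi (s i)).2 * (bi i).2))); last first.
    by move=> i _; rewrite mxE s1 mul1r.
  rewrite prodrXr coefXn; case: eqP => // dE.
  case/eqP: ne_s; apply/permP => i; rewrite perm1; apply: bi_inj.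
  rewrite [LHS]surjective_pairing [RHS]surjective_pairing -(eqP (s1 i)).
  congr pair; apply/eqP.
  (* Equal degrees force equality in the sum of the inequalities 2ab <= a^2 + b^2, hence in each of
     them: [s] preserves the y-exponents, and it already preserves the x-exponents. *)
  have /leqif_sum [_] : forall j, true ->
      (2 * ((bi (s j)).2 * (bi j).2) <= (bi (s j)).2 ^ 2 + (bi j).2 ^ 2
        ?= iff ((bi (s j)).2 == (bi j).2))%N by move=> j _; apply: nat_Cauchy.
  rewrite -big_distrr /= -dE big_split /= mul2n -addnn.
  rewrite -[X in (_ == X + _)%N](reindex_inj (@perm_inj _ s) (P := predT)
    (F := fun j => ((bi j).2 ^ 2)%N)) /=.
  rewrite (eq_bigr (fun j => (bi j).2 ^ 2)%N) // eqxx => /esym/forallP/(_ i).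
  by rewrite eq_sym.
by rewrite (bigD1 i) //= mxE (negPf si) !mul0r coef0.
Qed.

End Biexponents.

(** * Derivatives of Delta *)

Section Monomials.

Local Open Scope ring_scope.

Variable n : nat.
Implicit Types (m : 'X_{1..n + n}) (r : 'I_n -> nat * nat).

Definition expo m (i : 'I_n) : nat * nat := (m (xvar i), m (yvar i)).

Definition mon r : 'X_{1..n + n} :=
  (\sum_(i < n) (U_(xvar i) *+ (r i).1 + U_(yvar i) *+ (r i).2))%MM.

Definition ydeg m : nat := (\sum_(i < n) m (yvar i))%N.

Lemma eq_expo m m' : expo m =1 expo m' -> m = m'.
Proof.
move=> eq_m; apply/mnmP => k; case: (fintype.splitP k) => j kE.
  have -> : k = xvar j by apply: val_inj.
  by have [] := eq_m j.
have -> : k = yvar j by apply: val_inj.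
by have [] := eq_m j.
Qed.

Lemma expoD m m' i :
  expo (m + m')%MM i = ((expo m i).1 + (expo m' i).1, (expo m i).2 + (expo m' i).2)%N.
Proof. by rewrite /expo !mnmDE. Qed.

Lemma expo_mon r i : expo (mon r) i = r i.
Proof.
rewrite /expo /mon !mnm_sumE [RHS]surjective_pairing.
congr pair; rewrite (bigD1 i) //= big1 ?addn0 => [|j ne_j].
- by rewrite mnmDE !mulmnE !mnm1E eqxx eq_rlshift /= mul1n mul0n addn0.
- by rewrite mnmDE !mulmnE !mnm1E eq_rlshift eq_lshift (negPf ne_j) !mul0n.
- by rewrite mnmDE !mulmnE !mnm1E eqxx eq_lrshift /= mul1n mul0n.
- by rewrite mnmDE !mulmnE !mnm1E eq_lrshift eq_rshift (negPf ne_j) !mul0n.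
Qed.

Lemma ydegD m m' : ydeg (m + m')%MM = (ydeg m + ydeg m')%N.
Proof. by rewrite /ydeg -big_split; apply: eq_bigr => i _; rewrite mnmDE. Qed.

Lemma xdeg_eq0 m i : xdeg m = 0 -> m (xvar i) = 0.
Proof. by move/eqP; rewrite sum_nat_eq0 => /forallP/(_ i)/eqP. Qed.

Lemma prod_expo (F : nat -> nat) m :
  (\prod_(k < n + n) F (m k) = \prod_(i < n) (F (expo m i).1 * F (expo m i).2))%N.
Proof. by rewrite big_split_ord big_split. Qed.

End Monomials.

(** * Coefficients of derivatives and linear relations *)

Section Derivatives.

Local Open Scope ring_scope.

Variables (n : nat) (mu : seq nat).
Hypothesis size_mu : sumn mu = n.
Implicit Types (m : 'X_{1..n + n}) (r : 'I_n -> nat * nat).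

Local Notation bi := (@bi n mu).
Local Notation rowcoef := (@rowcoef n mu).
Local Notation Delta := (Delta n mu).

Definition moncoef m : rat := rowcoef (expo m).

Lemma mcoeff_Delta m : Delta@_m = moncoef m.
Proof.
rewrite /Delta /moncoef /rowcoef /determinant raddf_sum; apply: eq_bigr => s _.
have -> : \prod_(i < n) (\matrix_(i0 < n, j < n) ('X_(xvar i0) ^+ (bi j).1
     * 'X_(yvar i0) ^+ (bi j).2) : 'M[{mpoly rat[n + n]}]_n) i (s i)
   = 'X_[mon (fun i => bi (s i))].
  rewrite /mon -mprodXE; apply: eq_bigr => i _.
  by rewrite mxE mpolyXD !mpolyXn.
rewrite !mulr_sign /= (fun_if (mcoeff m)) mcoeffN mcoeffX.
suff -> : (mon (fun i => bi (s i)) == m)%:R = \prod_i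
    (\matrix_(i0 < n, j < n) (expo m i0 == bi j)%:R) i (s i) :> rat by [].
have [<-|/eqP ne_m] := eqVneq.
  by rewrite big1 // => i _; rewrite mxE expo_mon eqxx.
have [/forallP m_eq|/forallPn[i /negPf ne_i]] :=
  boolP [forall i, expo m i == bi (s i)].
  by case: ne_m; apply: eq_expo => i; rewrite expo_mon -(eqP (m_eq i)).
by rewrite (bigD1 i) //= mxE ne_i mul0r.
Qed.

(** All monomials of Delta have the biexponents as exponent pairs, hence this same product of
    factorials of exponents. *)
Definition hookfact : nat := (\prod_(j < n) ((bi j).1`! * (bi j).2`!))%N.

Definition mfact m : nat := (\prod_(k < n + n) (m k)`!)%N.

(** Differentiation contributes the factorials of [m1 + m2] over those of [m2]. The former are
    constant on the monomials of Delta, so the factor depends on [m2] alone. *)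
Lemma mcoeff_deriv_Delta m1 m2 :
  Delta^`M[m1]@_m2 = moncoef (m1 + m2)%MM * (hookfact%:R / (mfact m2)%:R).
Proof.
rewrite mcoeff_mderivm mcoeff_Delta -[LHS]mulr_natr.
have [->|nz] := eqVneq (moncoef (m1 + m2)%MM) 0; first by rewrite !mul0r.
have nz_fact : (mfact m2)%:R != 0 :> rat.
  by rewrite Num.Theory.pnatr_eq0 -lt0n /mfact; apply/prodn_gt0 => k; apply: fact_gt0.
congr (_ * _); apply: (mulIf nz_fact); rewrite divfK // -natrM; congr (_%:R).
rewrite -big_split /= /hookfact.
have [s sE] := rowcoef_neq0 nz.
rewrite [RHS](reindex_inj (@perm_inj _ s)) /=.
rewrite (eq_bigr (fun i => (expo (m1 + m2)%MM i).1`! * (expo (m1 + m2)%MM i).2`!)%N).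
  rewrite -(prod_expo factorial); apply: eq_bigr => k _.
  by rewrite mnmDE -[in X in (_ * X`!)%N](addKn (m1 k) (m2 k)) ffact_fact // leq_addr.
by move=> i _; rewrite sE.
Qed.

(** The coefficient at [m] of either side carries the same nonzero factor, so relations between
    derivatives reduce to relations between signs. *)
Lemma deriv_sum_eqP (I J : Type) (s : seq I) (t : seq J) (c : I -> rat) (d : J -> rat)
    (f : I -> 'X_{1..n + n}) (g : J -> 'X_{1..n + n}) :
  \sum_(i <- s) c i *: Delta^`M[f i] = \sum_(j <- t) d j *: Delta^`M[g j] <->
  (forall m, \sum_(i <- s) c i * moncoef (f i + m)%MM
             = \sum_(j <- t) d j * moncoef (g j + m)%MM).
Proof.
have coefE (K : Type) (u : seq K) (e : K -> rat) h m :
    (\sum_(i <- u) e i *: Delta^`M[h i])@_m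
    = (\sum_(i <- u) e i * moncoef (h i + m)%MM) * (hookfact%:R / (mfact m)%:R).
  rewrite raddf_sum mulr_suml; apply: eq_bigr => i _ /=.
  by rewrite mcoeffZ mcoeff_deriv_Delta mulrA.
have nz m : hookfact%:R / (mfact m)%:R != 0 :> rat.
  rewrite mulf_neq0 ?invr_eq0 // Num.Theory.pnatr_eq0 -lt0n;
    apply/prodn_gt0 => k.
    by rewrite muln_gt0 !fact_gt0.
  exact: fact_gt0.
split=> [/mpolyP eq_p m|eq_c]; first by apply: (mulIf (nz m)); rewrite -!coefE.
by apply/mpolyP => m; rewrite !coefE eq_c.
Qed.

Lemma moncoef_xdeg m : moncoef m != 0 -> xdeg m = nmu mu.
Proof.
case/rowcoef_neq0 => s sE; rewrite -(sum_bi1 size_mu).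
rewrite [RHS](reindex_inj (@perm_inj _ s)) /=.
by apply: eq_bigr => i _; rewrite -sE.
Qed.

Lemma moncoef_ydeg m : moncoef m != 0 -> ydeg m = (\sum_(j < n) (bi j).2)%N.
Proof.
case/rowcoef_neq0 => s sE; rewrite [RHS](reindex_inj (@perm_inj _ s)) /=.
by apply: eq_bigr => i _; rewrite -sE.
Qed.

Lemma expcoef_moncoef t m : (ydeg m <= \sum_(j < n) (bi j).2)%N ->
  expcoef mu t (expo m) = expcoef mu t bi * moncoef m.
Proof. exact: (@expcoef_rowcoef n mu size_mu t (expo m)). Qed.

(** In the expansion over [s], the monomial [g i] enters only through its value at the orbit point
    attached to [s]; the remaining factor depends on [m] and [s] alone. *)
Lemma expcoef_sum (I : finType) (c : I -> rat) (g : I -> 'X_{1..n + n}) t m :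
  (forall i, xdeg (g i) = 0) ->
  (forall s : 'S_n, \sum_i c i * \prod_(l < n) t ^+ ((bi (s l)).2 * g i (yvar l)) = 0) ->
  \sum_i c i * expcoef mu t (expo (g i + m)%MM) = 0.
Proof.
move=> g0 c0; pose a (s : 'S_n) := (-1) ^+ s * \prod_(l < n)
  (((expo m l).1 == (bi (s l)).1)%:R * t ^+ ((bi (s l)).2 * m (yvar l))) : rat.
transitivity (\sum_(s : 'S_n) a s *
    \sum_i c i * \prod_(l < n) t ^+ ((bi (s l)).2 * g i (yvar l))); last first.
  by rewrite big1 // => s _; rewrite c0 mulr0.
under [RHS]eq_bigr do rewrite mulr_sumr.
rewrite exchange_big; apply: eq_bigr => i _; rewrite /expcoef /determinant mulr_sumr.
apply: eq_bigr => s _; rewrite /a [LHS]mulrCA -!mulrA; congr (_ * _).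
rewrite [RHS]mulrCA; congr (_ * _).
rewrite -big_split; apply: eq_bigr => l _.
by rewrite mxE expoD /= xdeg_eq0 // add0n -mulrA -exprD -mulnDr addnC.
Qed.

(* If a combination of monomials in y vanishes on the orbit of the point with
   coordinates [t ^+ (bi j).2], its top homogeneous part annihilates Delta. *)
Lemma span_of_orbit (N : nat) (T : 'I_N -> 'X_{1..n + n}) b :
  (size (permutations [seq b.2 | b <- biexponents mu]) <= N)%N ->
  (forall j, xdeg (T j) = 0) ->
  (forall c : 'I_N -> rat, (forall m, \sum_j c j * moncoef (T j + m)%MM = 0) ->
     forall j, c j = 0) ->
  xdeg b = 0 ->
  exists c : 'I_N -> rat,
    forall m, moncoef (b + m)%MM = \sum_j c j * moncoef (T j + m)%MM.
Proof.
move=> le_N T0 T_free b0.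
set X := permutations _ in le_N; have [t t_nz] := exists_expcoef_neq0 size_mu.
(* The N + 1 monomials: [b] first, then the [T j]. *)
pose g i : 'X_{1..n + n} := if unlift ord0 i is Some j then T j else b.
have g0 i : xdeg (g i) = 0 by rewrite /g; case: unlift.
have gb : g ord0 = b by rewrite /g unlift_none.
have gT j : g (lift ord0 j) = T j by rewrite /g liftK.
(* Values of the monomials at the orbit points. There are at most N columns for N + 1 rows, so some
   nonzero combination of rows vanishes. *)
pose E : 'M[rat]_(N.+1, size X) := \matrix_(i, k)
  \prod_(l < n) t ^+ (nth 0 (nth [::] X k) l * g i (yvar l)).
have [v vE v_nz] : exists2 v : 'rV_N.+1, v *m E = 0 & v != 0.
  have: kermx E != 0.
    rewrite kermx_eq0 -row_leq_rank -ltnNge.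
    exact: leq_ltn_trans (rank_leq_col E) _.
  by case/rowV0Pn => v /sub_kermxP vE v_nz; exists v.
have v_orbit (s : 'S_n) :
    \sum_i v 0 i * \prod_(l < n) t ^+ ((bi (s l)).2 * g i (yvar l)) = 0.
  pose x := [seq (bi (s l)).2 | l <- enum 'I_n].
  have xX : x \in X.
    have -> : x = map (snd \o bi) (map s (enum 'I_n)).
      by rewrite -map_comp; apply: eq_map.
    rewrite mem_permutations -(codom_bi size_mu) /codom /image_mem -map_comp.
    apply: (@perm_map _ _ (snd \o bi)); apply: uniq_perm;
      rewrite ?(map_inj_uniq (@perm_inj _ s)) ?enum_uniq //.
    move=> i; rewrite mem_enum; apply/mapP; exists (s^-1%g i); rewrite ?mem_enum //.
    by rewrite permKV.
  have lt_x : (index x X < size X)%N by rewrite index_mem.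
  have /matrixP/(_ 0 (Ordinal lt_x)) := vE; rewrite !mxE => {2}<-.
  apply: eq_bigr => i _; rewrite !mxE /= nth_index //; congr (_ * _).
  apply: eq_bigr => l _; rewrite /x (nth_map l) ?size_enum_ord //.
  by rewrite nth_ord_enum.
have /rV0Pn[i0 vi0] := v_nz.
(* The top y-degree occurring in the combination; [d] keeps only the terms of this degree. *)
pose i1 := [arg max_(i > i0 | v 0%R i != 0%R) ydeg (g i)]%N.
have [vi1 le_i1] : v 0 i1 != 0 /\ forall i, v 0 i != 0 -> (ydeg (g i) <= ydeg (g i1))%N.
  by rewrite /i1; case: arg_maxnP.
pose d i : rat := if ydeg (g i) == ydeg (g i1) then v 0 i else 0.
(* Only one degree of [m] can complete the top part to the degree of Delta. For it, the lower terms
   fall short of that degree and vanish, so [v] and [d] give the same sum. *)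
have d0 m : \sum_i d i * moncoef (g i + m)%MM = 0.
  have [degE|ne_deg] := eqVneq (ydeg (g i1) + ydeg m)%N (\sum_(j < n) (bi j).2)%N;
    last first.
    rewrite big1 // => i _; rewrite /d; case: eqP => [gE|_]; last by rewrite mul0r.
    have [->|/moncoef_ydeg] := eqVneq (moncoef (g i + m)%MM) 0; first by rewrite mulr0.
    by rewrite ydegD gE => /eqP; rewrite (negPf ne_deg).
  apply: (mulfI t_nz); rewrite mulr0 mulr_sumr -[RHS](expcoef_sum m g0 v_orbit).
  apply: eq_bigr => i _; rewrite mulrCA /d.
  have [->|/le_i1 le_i] := eqVneq (v 0 i) 0; first by rewrite if_same !mul0r.
  rewrite expcoef_moncoef; last by rewrite ydegD; lia.
  case: eqP => [//|ne_i].
  have [->|/moncoef_ydeg] := eqVneq (moncoef (g i + m)%MM) 0; first by rewrite !mulr0.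
  by rewrite ydegD; lia.
have dE m : \sum_i d i * moncoef (g i + m)%MM =
    d ord0 * moncoef (b + m)%MM + \sum_j d (lift ord0 j) * moncoef (T j + m)%MM.
  rewrite big_ord_recl gb; congr (_ + _).
  by apply: eq_bigr => j _; rewrite gT.
(* Without [b], the top part would be a nontrivial relation between the [T j]. *)
have d_nz : d ord0 != 0.
  apply: contra_neq vi1 => d00.
  suff : d i1 = 0 by rewrite /d eqxx.
  have := T_free (fun j => d (lift ord0 j)).
  case: (unliftP ord0 i1) => [j ->|-> //]; apply => m.
  by rewrite -[RHS](d0 m) dE d00 mul0r add0r.
exists (fun j => - d (lift ord0 j) / d ord0) => m; apply: (mulfI d_nz).
have /eqP := d0 m; rewrite dE addr_eq0 => /eqP ->; rewrite mulr_sumr -sumrN.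
by apply: eq_bigr => j _; rewrite mulrA mulrCA divff // mulr1 mulNr.
Qed.

End Derivatives.

(** * The two bases *)

Section IndexedFamilies.

Local Open Scope ring_scope.

Variables (K : fieldType) (V : lmodType K) (I : eqType).
Implicit Types (A : I -> Prop) (v : I -> V) (W : V -> Prop).

Lemma in_span_sum (J : finType) A v (f : J -> I) (c : J -> K) :
  (forall j, A (f j)) -> in_span A v (\sum_j c j *: v (f j)).
Proof.
(* As [f] may repeat an index, coefficients are added up over its fibres. *)
move=> fA; exists (undup (codom f)), (fun i => \sum_(j | f j == i) c j).
split=> [i|]; first by rewrite mem_undup => /codomP[j ->].
transitivity (\sum_(i <- undup (codom f)) \sum_(j | f j == i) c j *: v (f j)).
  rewrite (exchange_big_dep predT) //=; apply: eq_bigr => j _.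
  rewrite big_mkcond (bigD1_seq (f j)) ?undup_uniq ?mem_undup ?codom_f //= eqxx.
  by rewrite big1 ?addr0 // => i /negPf; rewrite eq_sym => ->.
by apply: eq_bigr => i _; rewrite scaler_suml; apply: eq_bigr => j /eqP ->.
Qed.

(** Passage from a family selected by a predicate to one enumerated by an ordinal; freeness makes
    the enumeration injective. *)
Lemma indexed_is_basis N A v W (t : 'I_N -> I) :
  (forall i, A i <-> exists j, i = t j) ->
  (forall c : 'I_N -> K, \sum_j c j *: v (t j) = 0 -> forall j, c j = 0) ->
  (forall w, W w <-> exists c : 'I_N -> K, w = \sum_j c j *: v (t j)) ->
  is_basis A v W.
Proof.
move=> At t_free Wt; split=> [s c Us sA c0|w].
  have t_inj : injective t.
    move=> j k eq_t; apply/eqP; apply: contraT => ne_jk.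
    have := t_free (fun i => (i == j)%:R - (i == k)%:R).
    have sumE l : \sum_i (i == l)%:R *: v (t i) = v (t l).
      rewrite (bigD1 l) //= eqxx scale1r big1 ?addr0 // => i /negPf ->.
      by rewrite scale0r.
    under eq_bigr do rewrite scalerBl.
    rewrite sumrB !sumE eq_t subrr => /(_ erefl j) /eqP.
    by rewrite eqxx (negPf ne_jk) subr0 oner_eq0.
  pose c' j := if t j \in s then c (t j) else 0.
  have permE : perm_eq [seq t j | j <- enum 'I_N & t j \in s] s.
    apply: uniq_perm => // [|i].
      by rewrite (map_inj_uniq t_inj) filter_uniq ?enum_uniq.
    apply/mapP/idP => [[j]|si]; first by rewrite mem_filter => /andP[? _] ->.
    by have /At[j iE] := sA i si; exists j; rewrite // mem_filter -iE si mem_enum.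
  move=> i si; have /At[j iE] := sA i si; rewrite iE.
  suff /t_free/(_ j) : \sum_j c' j *: v (t j) = 0 by rewrite /c' -iE si.
  rewrite -[RHS]c0 -(perm_big _ permE) big_map big_filter big_enum_cond [RHS]big_mkcond /=.
  by apply: eq_bigr => k _; rewrite /c'; case: ifP; rewrite ?scale0r.
split=> [/Wt[c ->]|[s [c [sA ->]]]].
  by apply: in_span_sum => j; apply/At; exists j.
apply/Wt; elim: s sA => [|i s IH] sA.
  by exists (fun=> 0); rewrite big_nil big1 // => j _; rewrite scale0r.
have /At[j iE] : A i by apply: sA; rewrite mem_head.
have [|d dE] := IH; first by move=> k sk; apply: sA; rewrite inE sk orbT.
exists (fun k => (if k == j then c i else 0) + d k).
under [RHS]eq_bigr do rewrite scalerDl.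
rewrite big_cons big_split /= -dE; congr (_ + _).
rewrite (bigD1 j) //= eqxx iE big1 ?addr0 // => k /negPf ->.
by rewrite scale0r.
Qed.

End IndexedFamilies.

Lemma nth_mixed_bars nu v v' i : size v = size v' ->
  nth (0, 0)%N (mixed_bars nu v v') i =
  ((nth (0, 0) (bars nu v) i).1,
   (nth (0, 0) (bars nu v) i).2 - nth 0 v i + nth 0 v' i)%N.
Proof.
elim: v v' nu i => [|w v IH] [|w' v'] nu i //=; first by rewrite !nth_nil.
by case=> /IH {}IH; case: i => [|i] /=.
Qed.

Lemma size_mixed_bars nu v v' : size v = size v' ->
  size (mixed_bars nu v v') = size v.
Proof. by elim: v v' nu => [|w v IH] [|w' v'] nu //= [/IH ->]. Qed.

Lemma count_columns nu j :
  count_mem j [seq b.2 | b <- biexponents nu] = count (fun a => j < a)%N nu.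
Proof.
rewrite count_map -!sum1_count big_mkcond big_allpairs_dep /=.
rewrite [RHS]big_mkcond [RHS](big_nth 0%N) /index_iota subn0.
apply: eq_bigr => i _; rewrite -big_mkcond sum1_count.
by rewrite (count_uniq_mem j (iota_uniq _ _)) mem_iota; case: ltnP.
Qed.

(** * Diagrams of words and their pairing *)

Section Drawings.

Local Open Scope ring_scope.

Variables (n : nat) (mu : seq nat).
Hypothesis mu_part : is_partition n mu.

Let muA : antitone mu.
Proof. by case: mu_part => muS _ _; apply: sorted_antitone. Qed.

Let size_mu : sumn mu = n.
Proof. by case: mu_part. Qed.

Definition bar_diagram (v : seq nat) : diagram n :=
  [ffun i : 'I_n.-1 => nth (0, 0)%N (bars mu v) i].

Definition crossed_diagram (v : seq nat) : diagram n :=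
  [ffun i : 'I_n.-1 => ((nth (0, 0) (bars mu v) i).1,
                        (nth (0, 0) (bars mu v) i).2 - nth 0 v i)%N].

Definition white_diagram (v : seq nat) : diagram n :=
  [ffun i : 'I_n.-1 => (0%N, nth 0%N v i)].

Lemma codom_nth (T : eqType) (x0 : T) (s : seq T) k (f : {ffun 'I_k -> T}) :
  size s = k -> (forall i, f i = nth x0 s i) -> codom f = s.
Proof.
move=> szE fE; apply: (@eq_from_nth _ x0) => [|i].
  by rewrite size_codom card_ord.
rewrite size_codom card_ord => lt_i.
by rewrite codomE (nth_map (Ordinal lt_i)) ?size_enum_ord // fE nth_enum_ord.
Qed.

Lemma nth_codom (T : eqType) (x0 : T) k (f : {ffun 'I_k -> T}) (i : 'I_k) :
  nth x0 (codom f) i = f i.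
Proof. by rewrite codomE (nth_map i) ?size_enum_ord // nth_ord_enum. Qed.

Lemma le_word v i : v \in words mu n.-1 ->
  (nth 0 v i <= (nth (0, 0) (bars mu v) i).2)%N.
Proof.
rewrite -size_mu => vP; have [_ /(all_nthP ((0, 0), 0)%N) allP' _] := word_drawing muA vP.
have [lt_i|ge_i] := ltnP i (size v); last by rewrite nth_default.
have := allP' i; rewrite size_zip size_bars minnn nth_zip ?size_bars //.
exact.
Qed.

Lemma white_bar_crossed v : v \in words mu n.-1 ->
  white (bar_diagram v) (crossed_diagram v) = white_diagram v.
Proof.
by move=> vP; apply/ffunP => i; rewrite !ffunE /= subnn subKn // le_word.
Qed.

Lemma codom_bar_diagram v : v \in words mu n.-1 -> codom (bar_diagram v) = bars mu v.
Proof.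
move=> vP; apply: (codom_nth (x0 := (0, 0)%N)) => [|i]; last by rewrite ffunE.
by rewrite size_bars (size_words vP).
Qed.

Lemma is_drawingP B C : is_drawing mu B C <-> exists2 v, v \in words mu n.-1 &
  B = bar_diagram v /\ C = crossed_diagram v.
Proof.
split=> [[shB _ leC r1 r2 r3]|[v vP [-> ->]]].
  pose z := [seq (B i, (white B C i).2) | i <- enum 'I_n.-1].
  have z1 : unzip1 z = codom B by rewrite codomE /unzip1 -map_comp; apply: eq_map.
  have [||||vP zE] := @drawing_word mu z muA.
  - by rewrite size_map size_enum_ord size_mu.
  - by rewrite z1.
  - by apply/allP => _ /mapP[i _ ->]; rewrite /= ffunE leq_subr.
  - rewrite pairwise_map; have : pairwise ltn (map val (enum 'I_n.-1)).
      by rewrite val_enum_ord -(sorted_pairwise ltn_trans) iota_ltn_sorted.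
    rewrite pairwise_map; apply: sub_pairwise => i j /= lt_ij.
    apply/andP; split; apply/implyP => /= h; first exact/r1/eqP.
    by have := r3 _ _ lt_ij h; rewrite addn1.
  rewrite z1 size_mu in vP zE; exists (unzip2 z) => //.
  have BE i : B i = nth (0, 0)%N (bars mu (unzip2 z)) i by rewrite -zE nth_codom.
  split; apply/ffunP => i; rewrite !ffunE -BE //.
  have -> : nth 0%N (unzip2 z) i = (white B C i).2.
    by rewrite /unzip2 -map_comp (nth_map i) ?size_enum_ord // nth_ord_enum.
  by rewrite ffunE /= subKn // [LHS]surjective_pairing r2.
have [permB _ pwB] : [/\ perm_eq (bars mu v) (nonzero_biexponents mu),
    all (fun u => u.2 <= u.1.2)%N (zip (bars mu v) v)
    & pairwise rules (zip (bars mu v) v)].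
  by apply: word_drawing; rewrite // size_mu.
have wE := white_bar_crossed vP.
have rulesP (i j : 'I_n.-1) : (i < j)%N ->
    rules (nth (0, 0)%N (bars mu v) i, nth 0%N v i)
          (nth (0, 0)%N (bars mu v) j, nth 0%N v j).
  move=> lt_ij; rewrite -!nth_zip ?size_bars //.
  by move/pairwiseP: pwB; apply; rewrite ?inE ?size_zip ?size_bars ?minnn ?(size_words vP).
split.
- by rewrite /is_shape codom_bar_diagram.
- by move=> i; rewrite !ffunE.
- by move=> i; rewrite !ffunE leq_subr.
- by move=> i j /rulesP/andP[/implyP h _]; rewrite !ffunE => eq_ij; apply/h/eqP.
- by move=> i; rewrite !ffunE.
- by move=> i j /rulesP/andP[_ /implyP h]; rewrite wE !ffunE /= addn1; apply: h.
Qed.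

Lemma S_diagramsP S : S_diagrams mu S <->
  exists2 v, v \in words mu n.-1 & S = crossed_diagram v.
Proof.
split=> [[B [C [/is_drawingP[v vP [_ ->]] ->]]]|[v vP ->]]; first by exists v.
by exists (bar_diagram v), (crossed_diagram v); split=> //; apply/is_drawingP; exists v.
Qed.

Lemma T_diagramsP T : T_diagrams mu T <->
  exists2 v, v \in words mu n.-1 & T = white_diagram v.
Proof.
split=> [[B [C [/is_drawingP[v vP [-> ->]] ->]]]|[v vP ->]].
  by exists v; rewrite ?white_bar_crossed.
exists (bar_diagram v), (crossed_diagram v); rewrite white_bar_crossed //.
by split=> //; apply/is_drawingP; exists v.
Qed.

(** The list has length [n.-1]; the default (0,0) supplies the exponents of the last variables,
    which have no place. *)
Lemma expo_diag_mon (U : diagram n) i :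
  expo (diag_mon U) i = nth (0, 0)%N (codom U) i.
Proof.
suff -> : diag_mon U = mon (fun i : 'I_n => nth (0, 0)%N (codom U) i).
  by rewrite expo_mon.
rewrite /diag_mon /mon; clear i; move: U; rewrite /place; case: n => [|k] /= U.
  by rewrite !big_ord0.
rewrite big_ord_recr /= [nth _ _ k]nth_default ?size_codom ?card_ord //.
rewrite !mulm0n !addm0; apply: eq_bigr => i _; rewrite nth_codom.
by congr (U_(_) *+ _ + U_(_) *+ _)%MM; congr (_ _); apply: val_inj.
Qed.

Lemma perm_bars_biexponents (s : seq (nat * nat)) : size s = n.-1 ->
  perm_eq (codom (fun i : 'I_n => nth (0, 0)%N s i)) (biexponents mu)
  = perm_eq s (nonzero_biexponents mu).
Proof.
move=> szE; have szB := size_biexponents mu; rewrite size_mu in szB.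
(* For n = 0 there is no last variable to receive (0,0), although [n.-1] is again 0. *)
have [n0|n_gt0] := posnP n.
  have sz_codom : size (codom (fun i : 'I_n => nth (0, 0)%N s i)) = n.
    by rewrite size_codom card_ord.
  move: szE szB sz_codom; rewrite n0 /nonzero_biexponents => /size0nil ->.
  by move=> /size0nil -> /= /size0nil ->.
have -> : codom (fun i : 'I_n => nth (0, 0)%N s i) = rcons s (0, 0)%N.
  apply: (@eq_from_nth _ (0, 0)%N) => [|i].
    by rewrite size_codom card_ord size_rcons szE prednK.
  rewrite size_codom card_ord => lt_i.
  rewrite codomE (nth_map (Ordinal lt_i)) ?size_enum_ord // nth_enum_ord //.
  rewrite nth_rcons szE; case: ltngtP => // le_i.
    by rewrite nth_default // szE ltnW.
  by rewrite nth_default // szE le_i.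
rewrite perm_rcons; have B0 : perm_eq (biexponents mu) ((0, 0)%N :: nonzero_biexponents mu).
  apply: uniq_perm; rewrite /= ?mem_filter ?filter_uniq ?biexponents_uniq //.
  move=> b; rewrite inE mem_filter; case: (eqVneq b (0, 0)%N) => //= ->.
  rewrite -szB in n_gt0; have bP := mem_nth (0, 0)%N n_gt0.
  move: bP; rewrite !mem_biexponents /= => lt_b.
  exact: leq_trans (leq_ltn_trans (leq0n _) lt_b) (muA (leq0n _)).
by rewrite (permPr B0) perm_cons.
Qed.


Lemma moncoef_crossed_white v v' : size v = n.-1 -> size v' = n.-1 ->
  (moncoef mu (diag_mon (crossed_diagram v) + diag_mon (white_diagram v'))%MM != 0)
  = perm_eq (mixed_bars mu v v') (nonzero_biexponents mu).
Proof.
move=> szv szv'; have eq_sz : size v = size v' by rewrite szv.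
rewrite -perm_bars_biexponents ?size_mixed_bars //.
suff <- : codom (expo (diag_mon (crossed_diagram v) + diag_mon (white_diagram v'))%MM)
    = codom (fun i : 'I_n => nth (0, 0)%N (mixed_bars mu v v') i).
  exact: (sameP (rowcoef_neq0P size_mu _) idP).
apply: eq_codom => i; rewrite expoD !expo_diag_mon nth_mixed_bars //.
have [lt_i|ge_i] := ltnP i n.-1.
  by rewrite -[nat_of_ord i]/(val (Ordinal lt_i)) !nth_codom !ffunE /= addn0.
by rewrite !(nth_default (0, 0)%N) ?size_codom ?card_ord ?size_bars ?szv //
  !(nth_default 0%N) ?szv ?szv'.
Qed.

Local Notation N := (size (words mu n.-1)).
Let word (j : 'I_N) : seq nat := nth [::] (words mu n.-1) j.
Let Smon (j : 'I_N) : 'X_{1..n + n} := diag_mon (crossed_diagram (word j)).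
Let Tmon (j : 'I_N) : 'X_{1..n + n} := diag_mon (white_diagram (word j)).

Let word_mem j : word j \in words mu n.-1.
Proof. exact: mem_nth. Qed.

(** Up to the common factor [hookfact], the constant terms of d_S d_T' Delta. *)
Definition pairing : 'M[rat]_N := \matrix_(j, k) moncoef mu (Smon j + Tmon k)%MM.

(** Entries above the diagonal vanish by the lexicographic comparison of words; a diagonal entry
    recombines the two halves of one drawing into its shape. *)
Lemma pairing_unit : pairing \in unitmx.
Proof.
have trig : is_trig_mx pairing.
  apply/is_trig_mxP => j k lt_jk; rewrite mxE; apply/eqP/negPn.
  rewrite moncoef_crossed_white ?(size_words (word_mem _)) //.
  move/(pairwiseP [::]): (pairwise_words n.-1 muA) => /(_ j k).
  by apply; rewrite ?inE.
rewrite unitmxE (det_trig trig) unitfE; apply/prodf_neq0 => j _; rewrite mxE.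
have szj := size_words (word_mem j).
rewrite moncoef_crossed_white //.
have -> : mixed_bars mu (word j) (word j) = bars mu (word j).
  apply: (@eq_from_nth _ (0, 0)%N) => [|i _]; first by rewrite size_mixed_bars ?size_bars.
  rewrite nth_mixed_bars // subnK; first by rewrite -surjective_pairing.
  exact: le_word (word_mem j).
by have [] : [/\ perm_eq (bars mu (word j)) (nonzero_biexponents mu),
    all (fun u => u.2 <= u.1.2)%N (zip (bars mu (word j)) (word j))
    & pairwise rules (zip (bars mu (word j)) (word j))]
  by apply: word_drawing; rewrite // size_mu.
Qed.

Lemma xdeg_Tmon j : xdeg (Tmon j) = 0%N.
Proof.
rewrite /xdeg big1 // => i _.
have -> : Tmon j (xvar i) = (expo (Tmon j) i).1 by [].
rewrite expo_diag_mon; have [lt_i|ge_i] := ltnP i n.-1.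
  by rewrite -[nat_of_ord i]/(val (Ordinal lt_i)) nth_codom ffunE.
by rewrite nth_default // size_codom card_ord.
Qed.

(** A row of an invertible matrix has a nonzero entry, so S + T occurs in Delta for some T, and T
    contributes no x-degree. *)
Lemma xdeg_Smon j : xdeg (Smon j) = nmu mu.
Proof.
have [k nz] : exists k, pairing j k != 0.
  apply/existsP; apply: contraLR pairing_unit => /existsPn row0.
  rewrite unitmxE (expand_det_row _ j) big1 ?unitr0 // => k _.
  by have := row0 k; rewrite negbK => /eqP ->; rewrite mul0r.
move: nz; rewrite mxE => /(moncoef_xdeg size_mu).
by rewrite xdegD xdeg_Tmon addn0.
Qed.

Lemma Tmon_free (c : 'I_N -> rat) :
  (forall m, \sum_j c j * moncoef mu (Tmon j + m)%MM = 0) -> forall j, c j = 0.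
Proof.
move=> c0; have Pc0 : pairing *m (\col_j c j) = 0.
  apply/matrixP => i k; rewrite !mxE -[RHS](c0 (Smon i)).
  by apply: eq_bigr => j _; rewrite !mxE mulrC addmC.
have /matrixP c0' := mulKmx pairing_unit (\col_j c j).
by move=> j; have := c0' j 0; rewrite Pc0 mulmx0 !mxE.
Qed.

Lemma Smon_free (c : 'I_N -> rat) :
  (forall m, \sum_j c j * moncoef mu (Smon j + m)%MM = 0) -> forall j, c j = 0.
Proof.
move=> c0; have cP0 : (\row_j c j) *m pairing = 0.
  apply/matrixP => i k; rewrite !mxE -[RHS](c0 (Tmon k)).
  by apply: eq_bigr => j _; rewrite !mxE.
have /matrixP c0' := mulmxK pairing_unit (\row_j c j).
by move=> j; have := c0' 0 j; rewrite cP0 mul0mx !mxE.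
Qed.

(** The orbit points and the words are both counted by the multinomial coefficient of the column
    heights. *)
Lemma leq_permutations_words :
  (size (permutations [seq b.2 | b <- biexponents mu]) <= N)%N.
Proof.
have [n0|n_gt0] := posnP n.
  have : size (biexponents mu) = 0%N by rewrite size_biexponents size_mu.
  by move/size0nil => ->; rewrite n0.
have sum_mu : sumn mu = n.-1.+1 by rewrite prednK.
have lt_mu : all (fun a => a < nth 0 mu 0)%N [seq b.2 | b <- biexponents mu].
  apply/allP => _ /mapP[b bP ->]; move: bP; rewrite mem_biexponents => lt_b.
  exact: leq_trans lt_b (muA (leq0n _)).
have := card_words muA (leqnn _) sum_mu.
rewrite -sum_mu -size_biexponents -(size_map (fun b => b.2)) -(card_permutations lt_mu).
under [X in _ = (_ * X)%N]eq_bigr do rewrite count_columns.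
move=> /eqP; rewrite eqn_pmul2r => [/eqP ->|]; last first.
  by apply/prodn_gt0 => j; apply: fact_gt0.
by [].
Qed.

Lemma Tmon_span b : xdeg b = 0%N -> exists c : 'I_N -> rat,
  forall m, moncoef mu (b + m)%MM = \sum_j c j * moncoef mu (Tmon j + m)%MM.
Proof.
exact: (span_of_orbit size_mu leq_permutations_words xdeg_Tmon Tmon_free).
Qed.

(** The coefficients [u] are chosen to give the right pairing with every T. This suffices: an [m] of
    x-degree 0 acts as a combination of the T, and for any other [m] both sides vanish by degree. *)
Lemma Smon_span b : xdeg b = nmu mu -> exists c : 'I_N -> rat,
  forall m, moncoef mu (b + m)%MM = \sum_j c j * moncoef mu (Smon j + m)%MM.
Proof.
move=> bx; pose u := (\row_k moncoef mu (b + Tmon k)%MM) *m invmx pairing.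
have uP : u *m pairing = \row_k moncoef mu (b + Tmon k)%MM.
  exact: mulmxKV pairing_unit _.
exists (fun j => u 0 j) => m; have [m0|m_nz] := eqVneq (xdeg m) 0%N; last first.
  have coef0 b' : xdeg b' = nmu mu -> moncoef mu (b' + m)%MM = 0.
    move=> b'x; apply/eqP; apply: contraT => /(moncoef_xdeg size_mu).
    by rewrite xdegD b'x; move/eqP: m_nz; lia.
  by rewrite coef0 // big1 // => j _; rewrite coef0 ?mulr0 // xdeg_Smon.
have [e eE] := Tmon_span m0.
transitivity (\sum_k e k * (u *m pairing) 0 k).
  by rewrite addmC eE uP; apply: eq_bigr => k _; rewrite mxE addmC.
under eq_bigr do rewrite mxE mulr_sumr.
rewrite exchange_big; apply: eq_bigr => j _ /=.
rewrite [(Smon j + m)%MM]addmC eE mulr_sumr; apply: eq_bigr => k _.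
by rewrite mulrCA [pairing j k]mxE addmC.
Qed.

(** * From coefficients to the homogeneous parts of M *)

Lemma mcoeff_deriv_xdeg m1 m2 :
  (Delta n mu)^`M[m1]@_m2 != 0 -> (xdeg m1 + xdeg m2)%N = nmu mu.
Proof.
rewrite mcoeff_deriv_Delta mulf_eq0 => /norP[/(moncoef_xdeg size_mu)].
by rewrite xdegD.
Qed.

Lemma Mmu_xdeg_basisP d (f : 'I_N -> 'X_{1..n + n}) :
  (forall j, xdeg (f j) + d = nmu mu)%N ->
  (forall b, (xdeg b + d = nmu mu)%N -> exists c : 'I_N -> rat,
     forall m, moncoef mu (b + m)%MM = \sum_j c j * moncoef mu (f j + m)%MM) ->
  forall p, Mmu_xdeg mu d p <->
    exists c : 'I_N -> rat, p = \sum_j c j *: (Delta n mu)^`M[f j].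
Proof.
move=> fx f_span p; split=> [[[s [c [_ pE]]] p_hom]|[c ->]]; last first.
  split; first exact: (@in_span_sum _ _ _ _ (fun=> True) (fun m => (Delta n mu)^`M[m]) f c).
  apply: rpred_sum => j _; apply: rpredZ; apply/dhomogP => m; rewrite mcoeff_msupp.
  by move/mcoeff_deriv_xdeg => mE; apply: (@addnI (xdeg (f j))); rewrite fx.
(* Each derivative of Delta by a monomial is homogeneous in x, so only those of x-degree [d]
   contribute to [p]. *)
have {pE} -> : p = \sum_(m <- s | (xdeg m + d)%N == nmu mu) c m *: (Delta n mu)^`M[m].
  apply/mpolyP => m; rewrite {1}pE !raddf_sum /= [RHS]big_mkcond /=.
  have [mx|mx] := eqVneq (xdeg m) d.
    apply: eq_bigr => m' _; case: eqP => // ne_m'; rewrite mcoeffZ.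
    have [->|/mcoeff_deriv_xdeg] := eqVneq ((Delta n mu)^`M[m']@_m) 0.
      by rewrite mulr0.
    by rewrite mx.
  have := dhomog_nemf_coeff p_hom mx; rewrite {1}pE raddf_sum /= => ->.
  rewrite big1 // => m' _; case: eqP => // m'x; rewrite mcoeffZ.
  have [->|/mcoeff_deriv_xdeg] := eqVneq ((Delta n mu)^`M[m']@_m) 0.
    by rewrite mulr0.
  by move/eqP: mx; lia.
elim/big_rec: _ => [|m q /eqP mx [e ->]].
  by exists (fun=> 0); rewrite big1 // => j _; rewrite scale0r.
have [a aE] := f_span m mx; exists (fun j => c m * a j + e j).
under [RHS]eq_bigr do rewrite scalerDl -scalerA.
rewrite big_split -scaler_sumr; congr (_ *: _ + _).
have := (deriv_sum_eqP mu [:: tt] (index_enum 'I_N) (fun=> 1) a (fun=> m) f).2.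
rewrite !big_seq1 scale1r; apply => m'.
by rewrite big_seq1 mul1r aE.
Qed.

Lemma deriv_free (f : 'I_N -> 'X_{1..n + n}) :
  (forall c : 'I_N -> rat, (forall m, \sum_j c j * moncoef mu (f j + m)%MM = 0) ->
     forall j, c j = 0) ->
  forall c : 'I_N -> rat, \sum_j c j *: (Delta n mu)^`M[f j] = 0 -> forall j, c j = 0.
Proof.
move=> f_free c c0; apply: f_free => m.
have := (deriv_sum_eqP mu (index_enum 'I_N) [::] c (fun=> 0) f (fun k : unit => m)).1.
by rewrite big_nil => /(_ c0 m) ->; rewrite big_nil.
Qed.

Lemma S_is_basis : is_basis (@S_diagrams n mu) (fun S => diag_deriv S (Delta n mu))
  (@Mmu_xdeg n mu 0).
Proof.
apply: (indexed_is_basis (t := fun j => crossed_diagram (word j))).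
- move=> S; split=> [/S_diagramsP[v vP ->]|[j ->]]; last first.
    by apply/S_diagramsP; exists (word j).
  have lt_v : (index v (words mu n.-1) < N)%N by rewrite index_mem.
  by exists (Ordinal lt_v); rewrite /word /= nth_index.
- exact: deriv_free Smon_free.
- apply: (Mmu_xdeg_basisP (f := Smon)) => [j|b]; rewrite addn0; first exact: xdeg_Smon.
  exact: Smon_span.
Qed.

Lemma T_is_basis : is_basis (@T_diagrams n mu) (fun T => diag_deriv T (Delta n mu))
  (@Mmu_xdeg n mu (nmu mu)).
Proof.
apply: (indexed_is_basis (t := fun j => white_diagram (word j))).
- move=> T; split=> [/T_diagramsP[v vP ->]|[j ->]]; last first.
    by apply/T_diagramsP; exists (word j).
  have lt_v : (index v (words mu n.-1) < N)%N by rewrite index_mem.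
  by exists (Ordinal lt_v); rewrite /word /= nth_index.
- exact: deriv_free Tmon_free.
- apply: (Mmu_xdeg_basisP (f := Tmon)) => [j|b bx]; first by rewrite xdeg_Tmon.
  by apply: Tmon_span; lia.
Qed.

End Drawings.

Theorem theorem4 (n : nat) (mu : seq nat) (mu_part : is_partition n mu) :
  (lin_indep (@S_diagrams n mu) (fun S => diag_deriv S (Delta n mu)) /\
   is_basis (@S_diagrams n mu) (fun S => diag_deriv S (Delta n mu))
     (@Mmu_xdeg n mu 0)) /\
  (lin_indep (@T_diagrams n mu) (fun T => diag_deriv T (Delta n mu)) /\
   is_basis (@T_diagrams n mu) (fun T => diag_deriv T (Delta n mu))
     (@Mmu_xdeg n mu (nmu mu))).
Proof.
have S_basis := S_is_basis mu_part; have T_basis := T_is_basis mu_part.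
by split; split=> //; [case: S_basis|case: T_basis].
Qed.
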